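(* Let $n, t, N$ be positive integers with $t\ge 3$ and $N\ge n$. Then every $K_n$-covered graph $G$ on $N$ vertices satisfies $$i_t(G)\le \binom{N-n+1}{t}.$$ Moreover, when $N\ge n+t-1$, $S_{N,n-1}$ is the unique extremal graph; that is, a $K_n$-covered graph $G$ on $N$ vertices satisfies $i_t(G)=\binom{N-n+1}{t}$ if and only if $G\cong S_{N,n-1}$.
   Context: Graphs are finite and simple. For a given graph $H$, a graph $G$ is called $H$-covered if every vertex of $G$ is contained in at least one copy of $H$ in $G$ (a subgraph of $G$ isomorphic to $H$). $K_n$ denotes the complete graph on $n$ vertices. $i_t(G)$ denotes the number of independent sets of size $t$ in $G$. For integers $N\ge k\ge 0$, $S_{N,k}=K_k\vee\overline{K_{N-k}}$ is the join of the complete graph $K_k$ on $k$ vertices and the empty (edgeless) graph $\overline{K_{N-k}}$ on $N-k$ vertices; here the join $G_1\vee G_2$ is obtained from the disjoint union of $G_1$ and $G_2$ by adding all edges between $V(G_1)$ and $V(G_2)$. The binomial coefficient $\binom{a}{b}$ is $0$ when $0\le a<b$. *)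

(* Defs.v *)
From HB Require Import structures.
From mathcomp Require Import all_boot.

Set Implicit Arguments.
Unset Strict Implicit.
Unset Printing Implicit Defensive.

Record sgraph := SGraph {
  vert :> finType;
  edge : rel vert;
  edge_sym : symmetric edge;
  edge_irr : irreflexive edge }.

Arguments edge {s}.

Definition graph_iso (G H : sgraph) : Prop :=
  exists2 f : G -> H, bijective f & forall x y, edge (f x) (f y) = edge x y.

(* Subgraphs need not be induced, hence the separate edge relation. *)
Record subgraph (G : sgraph) := Subgraph {
  sub_vert : {set G};
  sub_edge : rel G;
  sub_edge_sym : symmetric sub_edge;
  sub_edgeP : forall x y, sub_edge x y ->
    [/\ x \in sub_vert, y \in sub_vert & edge x y] }.

Section GraphOfSubgraph.
Variables (G : sgraph) (S : subgraph G).

Definition subgraph_edge : rel {x : G | x \in sub_vert S} :=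
  fun x y => sub_edge S (val x) (val y).

Lemma subgraph_edge_sym : symmetric subgraph_edge.
Proof. by move=> x y; apply: sub_edge_sym. Qed.

Lemma subgraph_edge_irr : irreflexive subgraph_edge.
Proof.
by move=> x; apply/negP => /sub_edgeP [_ _]; rewrite edge_irr.
Qed.

Definition graph_of_subgraph : sgraph :=
  SGraph subgraph_edge_sym subgraph_edge_irr.

End GraphOfSubgraph.

Coercion graph_of_subgraph : subgraph >-> sgraph.

Definition covered (H G : sgraph) : Prop :=
  forall v : G, exists S : subgraph G, v \in sub_vert S /\ graph_iso S H.

Definition independent (G : sgraph) (A : {set G}) : bool :=
  [forall x in A, forall y in A, ~~ edge x y].

Definition indep_count (t : nat) (G : sgraph) : nat :=
  #|[set A : {set G} | independent A & #|A| == t]|.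

Definition complete_edge (n : nat) : rel 'I_n := fun x y => x != y.

Lemma complete_edge_sym n : symmetric (@complete_edge n).
Proof. by move=> x y; rewrite /complete_edge eq_sym. Qed.

Lemma complete_edge_irr n : irreflexive (@complete_edge n).
Proof. by move=> x; rewrite /complete_edge eqxx. Qed.

Definition complete_graph (n : nat) : sgraph :=
  SGraph (@complete_edge_sym n) (@complete_edge_irr n).

Definition empty_edge (n : nat) : rel 'I_n := fun _ _ => false.

Lemma empty_edge_sym n : symmetric (@empty_edge n).
Proof. by []. Qed.

Lemma empty_edge_irr n : irreflexive (@empty_edge n).
Proof. by []. Qed.

Definition empty_graph (n : nat) : sgraph :=
  SGraph (@empty_edge_sym n) (@empty_edge_irr n).

Definition join_edge (G H : sgraph) : rel (G + H)%type := fun u v =>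
  match u, v with
  | inl x, inl y => edge x y
  | inr x, inr y => edge x y
  | _, _ => true
  end.

Lemma join_edge_sym G H : symmetric (@join_edge G H).
Proof. by move=> [x|x] [y|y] //=; apply: edge_sym. Qed.

Lemma join_edge_irr G H : irreflexive (@join_edge G H).
Proof. by move=> [x|x] /=; apply: edge_irr. Qed.

Definition join (G H : sgraph) : sgraph :=
  SGraph (@join_edge_sym G H) (@join_edge_irr G H).

(* Meaningful for k <= N only, because of the truncated subtraction. *)
Definition split_graph (N k : nat) : sgraph :=
  join (complete_graph k) (empty_graph (N - k)).

(* Main.v *)
Require Import Defs.
From HB Require Import structures.
From mathcomp Require Import all_boot.
From mathcomp Require Import zify.

Set Implicit Arguments.
Unset Strict Implicit.
Unset Printing Implicit Defensive.

(** Write M = N - n. The proof is carried out for a family F of n-sets, here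
the vertex sets of the n-cliques of G, in place of G itself. A set is called
stable when it meets every member of F in at most one point; independent sets
of G are stable, so it suffices to bound the number i_t of stable t-sets of
cover F by C(M + 1, t). The gain is that F can be thinned out freely: removing
members keeps a family of n-sets, whereas removing vertices from a graph need
not leave a covered graph in which every edge lies in a clique.

Passing from t to t + 1 is easy ([stables_stepW]): if a is in a stable t-set A
and K is a member of F through a, then no point of A or of K extends A, so A
has at most M + 1 - t stable extensions, and
(t + 1) i_(t+1) <= (M + 1 - t) i_t. Everything rests on t = 3.

For t = 3 choose a point u that lies in as few members of F as possible, and
let U be the set of the x points lying in exactly the same members as u.
Discard the members through u. By minimality of u every point outside U still
lies in some remaining member ([cover_avoiding]), so exactly U has been
uncovered and induction on the number of points gives at most C(M - x + 1, 3)
stable triples that avoid U. A stable triple meeting U consists of one of the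
x points of U and of a stable pair inside the set Z of points separated from
u. Here |Z| <= M, and a member of F through w in Z is disjoint from U, so that
w is separated from at most M - x points of Z; hence there are at most
M (M - x) / 2 stable pairs in Z ([nonnbr_pairs]). Finally
  6 C(M + 1, 3) - 6 C(M - x + 1, 3) - 3 x M (M - x) = x^3 - x >= 0
([triple_arith]), which proves the bound.

If equality holds (and M >= 2) then x = 1, and Z is a stable set of size M, so
u together with Z is a stable set D of size M + 1 = N - (n - 1). Each
member of F has at most one point in D, hence contains all the n - 1
points outside D; these points are therefore adjacent to every other vertex.
Since equality also forces stable t-sets to be independent, D is independent
and G is the split graph ([extremal_split]). *)

(** * Stable sets of a set family *)

Section Families.
Variable T : finType.
Implicit Types (F : {set {set T}}) (A B D K X : {set T}) (u v w : T).

Definition stable F A : bool := [forall K in F, #|A :&: K| <= 1].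

Definition stables F X t : {set {set T}} :=
  [set A : {set T} | [&& A \subset X, stable F A & #|A| == t]].

Lemma stablesP F X t A :
  reflect [/\ A \subset X, stable F A & #|A| = t] (A \in stables F X t).
Proof.
rewrite inE; apply: (iffP and3P) => [[? ? /eqP ?]|[? ? ?]]; split=> //.
exact/eqP.
Qed.

Lemma stableP F A :
  reflect (forall K, K \in F -> #|A :&: K| <= 1) (stable F A).
Proof. exact: forall_inP. Qed.

Lemma stableS F A B : A \subset B -> stable F B -> stable F A.
Proof.
move=> sAB /stableP sB; apply/stableP => K FK.
by apply: leq_trans (sB K FK); rewrite subset_leq_card ?setSI.
Qed.

Lemma stable_fam F1 F2 A : F1 \subset F2 -> stable F2 A -> stable F1 A.
Proof.
by move=> /subsetP s12 /stableP sA; apply/stableP => K /s12; apply: sA.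
Qed.

Lemma stable_eq F A K v w :
  stable F A -> K \in F -> v \in A -> w \in A -> v \in K -> w \in K -> v = w.
Proof.
move=> /stableP sA /sA /card_le1_eqP le1 vA wA vK wK.
by apply: le1; rewrite inE ?vA ?wA.
Qed.

Lemma stable_pairs F A :
  (forall v w K, v \in A -> w \in A -> K \in F -> v \in K -> w \in K -> v = w) ->
  stable F A.
Proof.
move=> h; apply/stableP => K FK; apply/card_le1_eqP => v w.
rewrite !inE => /andP[vA vK] /andP[wA wK]; by apply: (h w v K).
Qed.

(** Double counting of the pairs (B, v) with B stable of size t + 1 and v in
B: the map to (B minus v, v) is injective. *)
Lemma stables_step F X t c :
  (forall A, A \in stables F X t ->
     #|[set v | (v \notin A) && (v |: A \in stables F X t.+1)]| <= c) ->
  t.+1 * #|stables F X t.+1| <= c * #|stables F X t|.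
Proof.
move=> hc.
pose S := stables F X t; pose S' := stables F X t.+1.
have -> : t.+1 * #|S'| = \sum_v #|[set B in S' | v \in B]|.
  rewrite mulnC -sum_nat_const.
  rewrite (eq_bigr (fun B : {set T} => \sum_(v in B) 1)); last first.
    by move=> B /stablesP[_ _ <-]; rewrite sum1_card.
  rewrite (exchange_big_dep predT) //=; apply: eq_bigr => v _.
  by rewrite -sum1_card; apply: eq_bigl => B; rewrite inE.
have hS : \sum_v #|[set A in S | (v \notin A) && (v |: A \in S')]| <= c * #|S|.
  rewrite (eq_bigr (fun v : T =>
    \sum_(A in S | (v \notin A) && (v |: A \in S')) 1)); last first.
    by move=> v _; rewrite -sum1_card; apply: eq_bigl => A; rewrite inE.
  rewrite (exchange_big_dep (mem S)) /=; last by move=> v A _ /andP[].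
  rewrite mulnC -sum_nat_const; apply: leq_sum => A SA.
  apply: leq_trans (hc A SA); rewrite -sum1_card.
  by rewrite leq_eqVlt; apply/orP; left; apply/eqP/eq_bigl => v; rewrite inE SA.
apply: leq_trans hS; apply: leq_sum => v _.
rewrite -(card_in_imset (f := fun B => B :\ v)); last first.
  move=> B1 B2; rewrite !inE => /andP[_ v1] /andP[_ v2] e.
  by rewrite -(setD1K v1) e setD1K.
apply: subset_leq_card; apply/subsetP => _ /imsetP[B + ->].
rewrite inE => /andP[BS vB]; rewrite inE setD1K // BS !inE eqxx /= andbT.
have /stablesP[sBX stB cB] := BS.
have sDB : B :\ v \subset B by apply: subsetDl.
rewrite (subset_trans sDB) // (stableS sDB) //=.
by move: (cardsD1 v B); rewrite vB cB; lia.
Qed.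

(** A member K of F through a point of A meets A only there, so the t + n - 1
points of A and K are all excluded as extensions of A. *)
Lemma stables_stepW F n t : 0 < t -> (forall K, K \in F -> #|K| = n) ->
  t.+1 * #|stables F (cover F) t.+1| <=
    (#|cover F| - n + 1 - t) * #|stables F (cover F) t|.
Proof.
move=> t_gt0 hn; apply: stables_step => A /stablesP[sAW stA cA].
have [a aA] : exists a, a \in A by apply/card_gt0P; rewrite cA.
have /bigcupP[K FK aK] := subsetP sAW a aA.
have sKW : K \subset cover F by apply: bigcup_sup.
have cI : #|A :&: K| = 1.
  apply/eqP; rewrite eqn_leq (stableP _ _ stA) //=.
  by apply/card_gt0P; exists a; rewrite inE aA.
have cU := cardsU A K; rewrite cI cA (hn _ FK) in cU.
have sUW : A :|: K \subset cover F by rewrite subUset sAW.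
have cKgt0 : 0 < #|K| by apply/card_gt0P; exists a.
rewrite (hn _ FK) in cKgt0.
have -> : #|cover F| - n + 1 - t = #|cover F :\: (A :|: K)|.
  rewrite cardsD (setIidPr sUW) cU.
  by have := subset_leq_card sKW; rewrite (hn _ FK); lia.
apply: subset_leq_card; apply/subsetP => v; rewrite inE => /andP[vA].
move=> /stablesP[/subsetP sW st _]; rewrite !inE negb_or vA sW ?setU11 //= andbT.
apply/negP => vK; move: vA.
by rewrite (stable_eq st FK _ _ vK aK) ?setU11 ?setU1r // aA.
Qed.

(** * Arithmetic of the bound for triples *)

Lemma six_binS3 k : 6 * 'C(k.+1, 3) + k = k ^ 3.
Proof.
have := bin_ffact k.+1 3; rewrite !ffactnS ffactn0 /=.
case: k => [|[|k]] //=; rewrite -[3`!]/6; nia.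
Qed.

(** The numerical core: with i2 <= (M - x) M / 2 the recursive estimate is off
by (x^3 - x) / 6, which leaves no room for equality unless x = 1. The
variable y is the number of points separated from the chosen one; keeping it
apart from M lets the equality case return y = M. *)
Lemma triple_arith M x y i i2 :
  0 < x -> i <= 'C(M - x + 1, 3) + x * i2 -> 2 * i2 <= (M - x) * y -> y <= M ->
  i <= 'C(M + 1, 3) /\
  (i = 'C(M + 1, 3) -> 2 <= M -> [/\ x = 1, y = M & i2 = 'C(M, 2)]).
Proof.
move=> x_gt0 hi h2 hy; rewrite !addn1 in hi *.
have e1 := six_binS3 M; have e2 := six_binS3 (M - x).
have e3 : 2 * 'C(M, 2) = M * M.-1.
  by have := bin_ffact M 2; rewrite !ffactnS ffactn0 -[2`!]/2; lia.
(* When M < x there are no pairs and the truncated M - x is 0. *)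
have [lt|le] := ltnP M x.
  have z : M - x = 0 by lia.
  rewrite z /= in e2 hi h2; have i20 : i2 = 0 by lia.
  rewrite i20 muln0 in hi; have i0 : i = 0.
    by move: hi; rewrite -[_ + 0]/0 leqn0 => /eqP.
  rewrite i0; split=> // h hM; exfalso.
  have : 0 < 'C(M.+1, 3) by rewrite bin_gt0.
  by rewrite -h.
set p := 'C(M.+1, 3) in e1 *; set q := 'C((M - x).+1, 3) in e2 hi.
have [z Mz] : exists z, M = x + z by exists (M - x); lia.
rewrite Mz addKn in e2 h2.
have h6 : 6 * i + z + 0 <= z ^ 3 + 3 * (x * (z * y)).
  have : x * (2 * i2) <= x * (z * y) by rewrite leq_mul2l h2 orbT.
  lia.
have hxy : x * (z * y) <= x * (z * M) by rewrite !leq_mul2l hy !orbT.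
have cube : M ^ 3 = x ^ 3 + z ^ 3 + 3 * (x * (z * M)).
  by rewrite Mz !expnS !expn0; nia.
have xx : x <= x ^ 3 by rewrite -[leqLHS]expn1 leq_pexp2l.
split; first by lia.
move=> ip hM.
have x1 : x = 1.
  have xx2 : 1 < x -> x < x ^ 3 by move=> x2; rewrite -[ltnLHS]expn1 ltn_exp2l.
  by move: xx2; lia.
subst x; rewrite !mul1n in hi h6 cube; clear hxy.
have ez : z = M.-1 by lia.
have yM : y = M.
  have : z * M <= z * y by lia.
  by rewrite leq_pmul2l; lia.
subst y; split=> //.
rewrite -ez mulnC in e3; lia.
Qed.

(** * Removing the members through a point of minimal degree *)

Definition star F v := [set K in F | v \in K].
Definition twins F u := [set v | star F v == star F u].
Definition avoiding F u := [set K in F | u \notin K].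
Definition nonnbrs F u := [set v in cover F | stable F [set u; v] & v != u].

Section Source.
Variables (F : {set {set T}}) (n : nat) (u : T).
Hypothesis F_n : forall K, K \in F -> #|K| = n.
Hypothesis u_cov : u \in cover F.

Hypothesis u_min : forall v, v \in cover F -> #|star F u| <= #|star F v|.

Local Notation U := (twins F u).
Local Notation F' := (avoiding F u).
Local Notation Z := (nonnbrs F u).

Lemma twinsP v K : v \in U -> K \in F -> (v \in K) = (u \in K).
Proof. by rewrite inE => /eqP/setP/(_ K); rewrite !inE => + FK; rewrite FK. Qed.

Lemma twins_cover : U \subset cover F.
Proof.
apply/subsetP => v vU; have /bigcupP[K FK uK] := u_cov.
by apply/bigcupP; exists K; rewrite ?(twinsP vU FK).
Qed.

(** Minimality of u enters only here: if all members through w contained u,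
then the star of w, being at least as large as that of u, would equal it. *)
Lemma cover_avoiding : cover F' = cover F :\: U.
Proof.
apply/setP => w; rewrite in_setD; apply/bigcupP/andP.
  move=> [K]; rewrite inE => /andP[FK uK] wK; split.
    by apply: contra uK => wU; rewrite -(twinsP wU).
  by apply/bigcupP; exists K.
move=> [wU wW]; have nsub : ~~ (star F w \subset star F u).
  apply: contra wU => sub; rewrite inE eqEcard sub; exact: u_min.
have /subsetPn[K] := nsub; rewrite !inE => /andP[FK wK]; rewrite FK /= => uK.
by exists K; rewrite // inE FK.
Qed.

Lemma nonnbrP w K : w \in Z -> K \in F -> u \in K -> w \notin K.
Proof.
rewrite inE => /and3P[_ st ne] FK uK; apply/negP => wK.
by move: ne; rewrite (stable_eq st FK _ _ wK uK) ?eqxx // ?set21 ?set22.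
Qed.

(** Twins of u lie in the same members as u, so a member that avoids u avoids
all of them at once. *)
Lemma nonnbr_clique w : w \in Z ->
  exists K, [/\ K \in F, w \in K, [disjoint K & U] & K \subset cover F].
Proof.
move=> wZ; have /bigcupP[K FK wK] : w \in cover F by move: wZ; rewrite inE => /and3P[].
have uK : u \notin K by apply: contraL wK; apply: nonnbrP.
exists K; split=> //; last exact: bigcup_sup.
rewrite disjoint_sym disjoint_subset; apply/subsetP => v vU.
by rewrite inE (twinsP vU FK).
Qed.

Lemma card_nonnbr : #|Z| <= #|cover F| - n.
Proof.
have /bigcupP[K FK uK] := u_cov.
have sK : K \subset cover F by apply: bigcup_sup.
have <- : #|cover F :\: K| = #|cover F| - n by rewrite cardsD (setIidPr sK) (F_n FK).
apply: subset_leq_card; apply/subsetP => w wZ; rewrite inE (nonnbrP wZ) //=.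
by move: wZ; rewrite inE => /and3P[].
Qed.

(** A member K through w excludes n points, and the points of U, which are
disjoint from both K and Z, are excluded as well. *)
Lemma nonnbr_pairs :
  2 * #|stables F Z 2| <= (#|cover F| - n - #|U|) * #|Z|.
Proof.
have le1 : #|stables F Z 1| <= #|Z|.
  rewrite -(card_imset _ (@set1_inj T)); apply: subset_leq_card.
  apply/subsetP => A /stablesP[sAZ _ /eqP/cards1P[w eA]]; subst A.
  by apply: imset_f; rewrite -sub1set.
apply: leq_trans (leq_mul (leqnn _) le1).
apply: stables_step => A /stablesP[sAZ _ /eqP/cards1P[w eA]]; subst A.
have [|K [FK wK dKU sK]] := @nonnbr_clique w; first by rewrite -sub1set.
have sKU : K :|: U \subset cover F by rewrite subUset sK twins_cover.
have -> : #|cover F| - n - #|U| = #|cover F :\: (K :|: U)|.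
  rewrite cardsD (setIidPr sKU) cardsU (disjoint_setI0 dKU) cards0 (F_n FK).
  by lia.
apply: subset_leq_card; apply/subsetP => v; rewrite inE => /andP[vw].
move=> /stablesP[/subsetP sZ st _].
have vZ : v \in Z by rewrite sZ ?setU11.
rewrite !inE negb_or; move: (vZ); rewrite inE => /and3P[-> stv vu].
rewrite andbT; apply/andP; split.
  apply: contra vw => vK; rewrite inE.
  by apply/eqP; apply: (stable_eq st FK); rewrite ?setU11 ?setU1r ?inE.
have /bigcupP[L FL uL] := u_cov.
apply: contra (nonnbrP vZ FL uL) => vU; rewrite (@twinsP v) // inE //.
Qed.

(** A member through u contains every twin of u, so a stable set has at most
one twin and its other points are separated from u. *)
Lemma split_triples :
  #|stables F (cover F) 3| <=
    #|stables F' (cover F') 3| + #|U| * #|stables F Z 2|.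
Proof.
have sF : F' \subset F by apply/subsetP => K; rewrite inE => /andP[].
rewrite -cardsX.
rewrite -(cardsID (stables F' (cover F') 3)) leq_add ?subset_leq_card ?subsetIr //.
apply: leq_trans (leq_imset_card (fun p => p.1 |: p.2) _).
apply: subset_leq_card; apply/subsetP => A; rewrite inE => /andP[nA].
move=> /stablesP[sAW stA cA].
have [v vA vU] : exists2 v, v \in A & v \in U.
  have /subsetPn[v vA] : ~~ (A \subset cover F').
    by apply: contra nA => sA; apply/stablesP; split=> //; apply: stable_fam stA.
  rewrite cover_avoiding inE (subsetP sAW) // andbT negbK => vU.
  by exists v.
apply/imsetP; exists (v, A :\ v); last by rewrite setD1K.
rewrite inE vU /=; apply/stablesP; split.
- apply/subsetP => w; rewrite inE => /andP[]; rewrite inE => wv wA.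
  have nK K : K \in F -> u \in K -> w \notin K.
    move=> FK uK; apply: contra wv => wK; apply/eqP.
    by apply: (stable_eq stA FK); rewrite ?(twinsP vU FK).
  rewrite inE (subsetP sAW) //=; apply/andP; split.
    apply: stable_pairs => x y K; rewrite !inE.
    move=> /orP[]/eqP-> /orP[]/eqP-> // FK => [uK wK|wK uK].
      by rewrite (negPf (nK K FK uK)) in wK.
    by rewrite (negPf (nK K FK uK)) in wK.
  have /bigcupP[K FK uK] := u_cov.
  by apply: contraNneq (nK K FK uK) => ->.
- by apply: stableS stA; apply: subsetDl.
- by move: (cardsD1 v A); rewrite vA cA; lia.
Qed.

(** The maximal number of stable pairs in Z means that all points of Z are
pairwise separated; they are separated from u by definition of Z. *)
Lemma full_nonnbr : let M := #|cover F| - n in 2 <= M ->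
  #|Z| = M -> #|stables F Z 2| = 'C(M, 2) ->
  exists D, [/\ D \subset cover F, #|D| = M + 1 & stable F D].
Proof.
move=> M M2 cZ c2; exists (u |: Z).
have uZ : u \notin Z by rewrite !inE eqxx !andbF.
have sZ : Z \subset cover F by apply/subsetP => w; rewrite inE => /and3P[].
split; first by rewrite subUset sub1set u_cov.
  by rewrite cardsU1 uZ cZ addnC.
have all2 : stables F Z 2 = [set A : {set T} | (A \subset Z) && (#|A| == 2)].
  apply/eqP; rewrite eqEcard cards_draws cZ c2 leqnn andbT.
  by apply/subsetP => A; rewrite !inE => /and3P[-> _ ->].
apply: stable_pairs => v w K; rewrite !in_setU1 => vuZ wuZ FK vK wK.
apply/eqP; apply: contraT => vw.
case/orP: vuZ => [/eqP vu|vZ]; case/orP: wuZ => [/eqP wu|wZ].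
- by rewrite vu wu eqxx in vw.
- by subst v; rewrite (negPf (nonnbrP wZ FK vK)) in wK.
- by subst w; rewrite (negPf (nonnbrP vZ FK wK)) in vK.
have : [set v; w] \in stables F Z 2.
  by rewrite all2 inE cards2 vw subUset !sub1set vZ wZ.
move=> /stablesP[_ st _]; move: vw.
by rewrite (stable_eq st FK (set21 _ _) (set22 _ _) vK wK) eqxx.
Qed.

End Source.

(** * Bounds on the number of stable sets *)

Theorem stable_triples F n : (forall K, K \in F -> #|K| = n) ->
  let M := #|cover F| - n in
  #|stables F (cover F) 3| <= 'C(M + 1, 3) /\
  (#|stables F (cover F) 3| = 'C(M + 1, 3) -> 2 <= M ->
   exists D, [/\ D \subset cover F, #|D| = M + 1 & stable F D]).
Proof.
have [k] := ubnP #|cover F|; elim: k F => // k IHk F ltk F_n M.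
have [W0|/set0Pn[u0 u0W]] := eqVneq (cover F) set0.
  have M0 : M = 0 by rewrite /M W0 cards0.
  rewrite M0; split=> //; rewrite bin_small // leqn0 cards_eq0 -subset0; apply/subsetP => A.
  rewrite W0 => /stablesP[]; rewrite subset0 => /eqP-> _.
  by rewrite cards0.
case: (@arg_minnP _ u0 (mem (cover F)) (fun v => #|star F v|)) => //.
move=> u uW u_min.
have := split_triples uW u_min; have := nonnbr_pairs F_n uW.
have := @full_nonnbr F n u uW; have := card_nonnbr F_n uW.
move=> cZ full pairs split3.
have U_gt0 : 0 < #|twins F u| by apply/card_gt0P; exists u; rewrite inE.
have cW' : #|cover (avoiding F u)| = #|cover F| - #|twins F u|.
  by rewrite (cover_avoiding u_min) cardsD (setIidPr (twins_cover uW)).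
have [||bound _] := IHk (avoiding F u).
- by rewrite cW'; have := subset_leq_card (twins_cover uW); lia.
- by move=> K; rewrite inE => /andP[/F_n].
rewrite cW' in bound.
have eM : #|cover F| - #|twins F u| - n = M - #|twins F u| by rewrite /M; lia.
rewrite eM in bound.
have [le eq] := triple_arith U_gt0
  (leq_trans split3 (leq_add bound (leqnn _))) pairs cZ.
split=> // e M2; have [_ eZ e2] := eq e M2; exact: full.
Qed.

(** Equality for t + 1 propagates down to t because the factor M + 1 - t is
positive as long as t + 1 <= M + 1, so the structure is always read off from
the case of triples. *)
Theorem stables_bound F n t : (forall K, K \in F -> #|K| = n) -> 3 <= t ->
  let M := #|cover F| - n in
  #|stables F (cover F) t| <= 'C(M + 1, t) /\
  (#|stables F (cover F) t| = 'C(M + 1, t) -> t <= M + 1 ->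
   exists D, [/\ D \subset cover F, #|D| = M + 1 & stable F D]).
Proof.
move=> F_n t_ge3 M; elim: t t_ge3 => // t IHt; rewrite leq_eqVlt => /orP[/eqP<-|t_ge3].
  have [le ext] := stable_triples F_n; split=> // e M2; apply: ext => //.
  by rewrite -/M; lia.
have [//|le ext] := IHt.
have t_gt0 : 0 < t by lia.
have := stables_stepW t_gt0 F_n; rewrite -/M => step.
have binS := mul_bin_left (M + 1) t.
have le' : (M + 1 - t) * #|stables F (cover F) t| <= (M + 1 - t) * 'C(M + 1, t).
  by rewrite leq_mul2l le orbT.
split=> [|e tM].
  by rewrite -(leq_pmul2l (ltn0Sn t)) binS (leq_trans step).
apply: ext; last exact: ltnW.
apply/eqP; rewrite eqn_leq le -(@leq_pmul2l (M + 1 - t)) ?subn_gt0 //.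
by rewrite -binS -e.
Qed.

End Families.

(** * Cliques and copies of the complete graph *)

Definition clique (G : sgraph) (K : {set G}) : bool :=
  [forall x in K, forall y in K, (x != y) ==> edge x y].

Definition cliques n (G : sgraph) : {set {set G}} :=
  [set K : {set G} | clique K & #|K| == n].

(** G is the join of a complete graph on the complement of D and an edgeless
graph on D. Used instead of isomorphism with a split graph, because it can be
checked inside G. *)
Definition split_by (G : sgraph) (D : {set G}) : Prop :=
  forall x y : G, edge x y = (x != y) && ~~ ((x \in D) && (y \in D)).

Lemma cliqueP (G : sgraph) (K : {set G}) :
  reflect {in K &, forall x y, x != y -> edge x y} (clique K).
Proof.
apply: (iffP forall_inP) => [h x y xK yK|h x xK].
  by move/forall_inP: (h x xK) => /(_ y yK)/implyP.
by apply/forall_inP => y yK; apply/implyP; apply: h.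
Qed.

Lemma independentP (G : sgraph) (A : {set G}) :
  reflect {in A &, forall x y, ~~ edge x y} (independent A).
Proof.
apply: (iffP forall_inP) => [h x y xA yA|h x xA].
  by move/forall_inP: (h x xA) => /(_ y yA).
by apply/forall_inP => y yA; apply: h.
Qed.

Section CliqueSubgraph.
Variables (G : sgraph) (K : {set G}).
Hypothesis K_clique : clique K.

Let e : rel G := fun x y => [&& x \in K, y \in K & x != y].

Let e_sym : symmetric e.
Proof. by move=> x y; rewrite /e eq_sym andbCA. Qed.

Let eP x y : e x y -> [/\ x \in K, y \in K & edge x y].
Proof. by case/and3P=> xK yK xy; split=> //; apply: (cliqueP _ K_clique). Qed.

Definition clique_subgraph := Subgraph e_sym eP.

Lemma clique_subgraph_iso n : #|K| = n ->
  graph_iso clique_subgraph (complete_graph n).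
Proof.
move=> <-; exists (fun x : {x | x \in K} => enum_rank_in (valP x) (val x)).
  apply: inj_card_bij; last by rewrite card_ord card_sig.
  move=> x y /(congr1 enum_val).
  by rewrite !enum_rankK_in ?(valP x) ?(valP y) //; apply: val_inj.
move=> x y; rewrite /= /complete_edge /subgraph_edge /= /e.
rewrite (valP x) (valP y) /=; congr negb; apply/eqP/eqP => [/(congr1 enum_val)|xy].
  by rewrite !enum_rankK_in ?(valP x) ?(valP y).
by apply: enum_val_inj; rewrite !enum_rankK_in ?(valP x) ?(valP y).
Qed.

End CliqueSubgraph.

Lemma covered_cliques (G : sgraph) n :
  covered (complete_graph n) G <-> cover (cliques n G) = [set: G].
Proof.
split=> [cov|cov v].
  apply/setP => v; rewrite in_setT; have [S [vS [f f_bij f_edge]]] := cov v.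
  apply/bigcupP; exists (sub_vert S) => //; rewrite inE; apply/andP; split.
    apply/cliqueP => x y xS yS xy.
    pose x' : graph_of_subgraph S := Sub x xS; pose y' : graph_of_subgraph S := Sub y yS.
    have : edge x' y'.
      rewrite -f_edge /= /complete_edge (inj_eq (bij_inj f_bij)).
      by apply: contra xy => /eqP[->].
    by move=> /sub_edgeP[].
  by rewrite -card_sig (bij_eq_card f_bij) card_ord.
have /bigcupP[K] : v \in cover (cliques n G) by rewrite cov in_setT.
rewrite inE => /andP[clK /eqP cK] vK.
by exists (clique_subgraph clK); split=> //; apply: clique_subgraph_iso.
Qed.

Lemma independent_stable (G : sgraph) n (A : {set G}) :
  independent A -> stable (cliques n G) A.
Proof.
move=> /independentP iA; apply: stable_pairs => v w K vA wA.
rewrite inE => /andP[/cliqueP clK _] vK wK; apply/eqP; apply: contraT => vw.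
by have := iA v w vA wA; rewrite clK.
Qed.

(** * Split graphs *)

Lemma split_by_graph N k : k <= N ->
  exists2 D : {set split_graph N k}, #|D| = N - k & split_by D.
Proof.
move=> kN; pose D : {set split_graph N k} := [set inr j | j : 'I_(N - k)].
have inl_out i : (inl i \in D) = false by apply/imsetP => -[].
have inr_in i : inr i \in D by apply: imset_f.
exists D; first by rewrite card_imset ?card_ord //; apply: inr_inj.
by move=> [x|x] [y|y] /=; rewrite ?inl_out ?inr_in //= ?andbF ?andbT.
Qed.

Lemma card_split_graph N k : k <= N -> #|split_graph N k| = N.
Proof. by move=> kN; rewrite card_sum !card_ord subnKC. Qed.

Lemma iso_split_by (G H : sgraph) (f : G -> H) (E : {set H}) :
  bijective f -> (forall x y, edge (f x) (f y) = edge x y) -> split_by E ->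
  exists2 D : {set G}, #|D| = #|E| & split_by D.
Proof.
move=> f_bij f_edge sE; have [g fK gK] := f_bij; exists (f @^-1: E).
  rewrite -[in RHS](card_imset E (can_inj gK)); apply: eq_card => x.
  by rewrite inE -[x in RHS]fK mem_imset //; apply: can_inj gK.
by move=> x y; rewrite -f_edge sE (inj_eq (bij_inj f_bij)) !inE.
Qed.

Lemma split_by_iso (G : sgraph) N k (D : {set G}) : k <= N -> #|G| = N ->
  #|D| = N - k -> split_by D -> graph_iso G (split_graph N k).
Proof.
move=> kN cG cD sD.
have cC : k = #|~: D| by rewrite cardsCs setCK cG cD; lia.
pose h (s : split_graph N k) : G := match s with
  | inl i => enum_val (cast_ord cC i)
  | inr j => enum_val (cast_ord (esym cD) j) end.
have hD s : (h s \in D) = if s is inr _ then true else false.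
  case: s => i /=; last exact: enum_valP.
  by have := enum_valP (cast_ord cC i); rewrite inE => /negPf.
have h_inj : injective h.
  move=> s s' e; have := hD s'; rewrite -e hD.
  by case: s s' e => i [j|j] //= /enum_val_inj/cast_ord_inj->.
have [|f hK fK] := inj_card_bij h_inj; first by rewrite card_split_graph // cG.
exists f; first by exists h.
move=> x y; rewrite -[x]fK -[y]fK !hK sD (inj_eq h_inj) !hD.
by case: (f x) (f y) => i [j|j] //=; rewrite ?andbT ?andbF.
Qed.

(** Every independent set with two or more points lies in D, since a point
outside D is adjacent to all others. *)
Lemma indep_count_split (G : sgraph) (D : {set G}) t :
  split_by D -> 1 < t -> indep_count t G = 'C(#|D|, t).
Proof.
move=> sD t_gt1; rewrite -cards_draws; apply: eq_card => A; rewrite !inE.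
apply/andP/andP => -[hA /eqP cA]; split; rewrite ?cA //.
  apply/subsetP => x xA; have : 0 < #|A :\ x|.
    by move: (cardsD1 x A); rewrite xA cA; lia.
  case/card_gt0P => y; rewrite !inE => /andP[yx yA].
  have := independentP _ hA x y xA yA; rewrite sD eq_sym yx negbK.
  by case/andP.
apply/independentP => x y /(subsetP hA) xD /(subsetP hA) yD.
by rewrite sD xD yD andbF.
Qed.

(** The cliques are the sets formed by one point of D and the complement of D. *)
Lemma split_covered (G : sgraph) (D : {set G}) n : 0 < n -> 0 < #|D| ->
  #|~: D| = n - 1 -> split_by D -> covered (complete_graph n) G.
Proof.
move=> n_gt0 /card_gt0P[d dD] cC sD; apply/covered_cliques/setP => v.
rewrite in_setT; have [w wD vw] : exists2 w, w \in D & v \in w |: ~: D.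
  have [vD|vD] := boolP (v \in D); first by exists v; rewrite ?setU11.
  by exists d; rewrite // !inE vD orbT.
apply/bigcupP; exists (w |: ~: D) => //; rewrite inE; apply/andP; split.
  apply/cliqueP => x y; rewrite !inE => hx hy xy; rewrite sD xy /=.
  apply/negP => /andP[xD yD]; rewrite xD yD !orbF in hx hy.
  by rewrite (eqP hx) (eqP hy) eqxx in xy.
by rewrite cardsU1 cC inE wD; apply/eqP; lia.
Qed.

Lemma superset_of_card (T : finType) (A D : {set T}) t :
  A \subset D -> #|A| <= t <= #|D| ->
  exists B : {set T}, [/\ A \subset B, B \subset D & #|B| = t].
Proof.
move=> sAD /andP[At tD].
have : 0 < #|[set B : {set T} | B \subset D :\: A & #|B| == t - #|A|]|.
  by rewrite cards_draws bin_gt0 cardsD (setIidPr sAD) leq_sub2r.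
case/card_gt0P => B; rewrite inE subsetD => /andP[/andP[sBD dBA] /eqP cB].
exists (A :|: B); rewrite subsetUl subUset sAD sBD; split=> //.
by rewrite cardsU setIC (disjoint_setI0 dBA) cards0 cB; lia.
Qed.

(** A clique of size n has at most one point in D, and only n - 1 vertices lie
outside D, so each clique contains all of these. Inside D, a pair of points
extends to a stable t-set, which is independent because the two counts
agree. *)
Lemma extremal_split (G : sgraph) n t (D : {set G}) :
  cover (cliques n G) = [set: G] -> 0 < n <= #|G| -> 1 < t <= #|D| ->
  #|D| = #|G| - n + 1 -> stable (cliques n G) D ->
  indep_count t G = #|stables (cliques n G) [set: G] t| -> split_by D.
Proof.
move=> cov /andP[n_gt0 nG] /andP[t_gt1 tD] cD stD eq_count.
have indep_eq : [set A : {set G} | independent A & #|A| == t] =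
    stables (cliques n G) [set: G] t.
  apply/eqP; rewrite eqEcard -eq_count leqnn andbT; apply/subsetP => A.
  rewrite !inE => /andP[iA ->]; rewrite subsetT independent_stable //.
have cC : #|~: D| = n - 1 by rewrite cardsCs setCK cD; lia.
have out x y : y \notin D -> x != y -> edge x y.
  move=> yD xy; have /bigcupP[K FK xK] : x \in cover (cliques n G).
    by rewrite cov in_setT.
  have := FK; rewrite inE => /andP[/cliqueP clK /eqP cK].
  apply: clK => //; suff : ~: D \subset K.
    by move/subsetP; apply; rewrite inE.
  suff <- : K :\: D = ~: D by apply: subsetDl.
  apply/eqP; rewrite eqEcard setDE subsetIr cC -setDE.
  have := stableP _ _ stD K FK; have := cardsID D K; rewrite setIC; lia.
move=> x y; have [<-|xy] := eqVneq x y; first by rewrite edge_irr.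
have [yD|yD] := boolP (y \in D); last by rewrite andbF out.
have [xD|xD] := boolP (x \in D); last by rewrite edge_sym out // eq_sym.
have sxyD : [set x; y] \subset D by rewrite subUset !sub1set xD.
have [|B [sB BD cB]] := superset_of_card sxyD (t := t).
  by rewrite cards2 xy t_gt1.
have : B \in stables (cliques n G) [set: G] t.
  by apply/stablesP; split=> //; apply: stableS stD.
rewrite -indep_eq inE => /andP[/independentP iB _]; apply/negbTE.
by apply: iB; apply: (subsetP sB); rewrite ?set21 ?set22.
Qed.

(** * The extremal theorem *)

Theorem theorem1p2 (n t N : nat) (n_gt0 : 0 < n) (t_ge3 : 3 <= t)
    (N_gt0 : 0 < N) (n_le_N : n <= N) :
  (forall G : sgraph, #|G| = N -> covered (complete_graph n) G ->
     indep_count t G <= 'C(N - n + 1, t)) /\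
  (n + t - 1 <= N ->
     [/\ #|split_graph N (n - 1)| = N,
         covered (complete_graph n) (split_graph N (n - 1)) &
         forall G : sgraph, #|G| = N -> covered (complete_graph n) G ->
           (indep_count t G = 'C(N - n + 1, t) <->
            graph_iso G (split_graph N (n - 1)))]).
Proof.
have k_le_N : n - 1 <= N by lia.
have eD : N - (n - 1) = N - n + 1 by lia.
have cliques_n (G : sgraph) K : K \in cliques n G -> #|K| = n.
  by rewrite inE => /andP[_ /eqP].
have le_stables (G : sgraph) :
    indep_count t G <= #|stables (cliques n G) [set: G] t|.
  apply: subset_leq_card; apply/subsetP => A; rewrite !inE => /andP[iA ->].
  by rewrite subsetT independent_stable.
split=> [G cG /covered_cliques cov|tN].
  have [] := stables_bound (@cliques_n G) t_ge3; rewrite cov cardsT cG => le _.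
  exact: leq_trans (le_stables G) le.
have [E cE sE] := split_by_graph k_le_N.
split; first exact: card_split_graph.
  apply: split_covered sE; rewrite // ?cE; first by lia.
  by rewrite cardsCs setCK card_split_graph // cE; lia.
move=> G cG /covered_cliques cov; split=> [eq_count|[f f_bij f_edge]].
  have [] := stables_bound (@cliques_n G) t_ge3; rewrite cov cardsT cG => le ext.
  have eq_stables : indep_count t G = #|stables (cliques n G) [set: G] t|.
    by apply/eqP; rewrite eqn_leq le_stables eq_count.
  have [||D [_ cD stD]] := ext; [by rewrite -eq_stables | by lia |].
  apply: (split_by_iso (D := D)) => //; first by rewrite cD eD.
  by apply: (extremal_split cov _ _ _ stD eq_stables); rewrite ?cG ?cD; lia.
have [D cD sD] := iso_split_by f_bij f_edge sE.
by rewrite (indep_count_split sD) ?cD ?cE ?eD //; lia.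
Qed.
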